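(* There is a nonempty Zariski-open subset $U$ of the space $\mathcal{A}_2$ of quadratic vector fields on $\mathbb{C}^2$ such that for every $v\in U$ the following holds. If $w$ is a quadratic vector field with four non-degenerate singular points in $\mathbb{C}^2$ which has the same spectra of singularities as $v$ and the same (unordered) triple of characteristic numbers at infinity as $v$, then $w$ is affine equivalent to $v$.
   Context: A quadratic vector field is $v=P\,\partial_x+Q\,\partial_y$ with $P,Q\in\mathbb{C}[x,y]$ of degree at most $2$, and $\mathcal{A}_2$ is the space of these. A singular point $p$ (a common zero of $P,Q$) is non-degenerate if $\det Dv(p)\ne0$, where $Dv$ is the Jacobian matrix of $(P,Q)$. The spectrum at $p$ is $(\operatorname{tr}Dv(p),\det Dv(p))$. Two fields have the same spectra of singularities if the multisets of spectra over their singular points coincide, regardless of position. Affine equivalence means $w(x,y)=DT\cdot v(T^{-1}(x,y))$ for some affine map $T$ of $\mathbb{C}^2$. Characteristic numbers at infinity: let $P_2,Q_2$ be the homogeneous degree-2 parts of $P,Q$, and set $p(t)=P_2(1,t)$, $q(t)=Q_2(1,t)$. In coordinates $z=1/x$, $w=y/x$ near the line at infinity $\{z=0\}$, the foliation of $v$ has linear part $dz/dw = z\,R(w)$ with $R(w)=-p(w)/(q(w)-w\,p(w))$. Generically the cubic $q(t)-t\,p(t)$ has three distinct roots $w_1,w_2,w_3$, which correspond to the singular points at infinity. The characteristic numbers at infinity are $\mu_j=\operatorname{Res}_{w=w_j}R(w)$ for $j=1,2,3$, and they satisfy $\mu_1+\mu_2+\mu_3=1$. *)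

(* Defs.v *)
(* The complex field C is modelled by an arbitrary
   numClosedFieldType (algebraically closed, characteristic 0). *)
From HB Require Import structures.
From mathcomp Require Import all_boot all_order all_algebra.
Set Implicit Arguments. Unset Strict Implicit. Unset Printing Implicit Defensive.
Import Order.TTheory GRing.Theory Num.Theory.
Local Open Scope ring_scope.

Section QVF.
Variable C : numClosedFieldType.

Inductive mpoly (n : nat) : Type :=
| MConst of C
| MVar of 'I_n
| MAdd of mpoly n & mpoly n
| MMul of mpoly n & mpoly n.

Fixpoint meval (n : nat) (e : 'I_n -> C) (p : mpoly n) : C :=
  match p with
  | MConst c => c
  | MVar i => e i
  | MAdd p q => meval e p + meval e q
  | MMul p q => meval e p * meval e q
  end.

Definition zariski_open (n : nat) (U : ('I_n -> C) -> Prop) : Prop :=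
  exists ps : seq (mpoly n),
    forall e, U e <-> ~ (all (fun p => meval e p == 0) ps).

(* v : 'I_12 -> C encodes
   P = v0 + v1 x + v2 y + v3 x^2 + v4 x y + v5 y^2
   Q = v6 + v7 x + v8 y + v9 x^2 + v10 x y + v11 y^2 ; A_2 = C^12 *)
Definition qvf := 'I_12 -> C.

Definition cf (v : qvf) (k : nat) : C := v (inord k).

Definition Pf (v : qvf) (x y : C) : C :=
  cf v 0 + cf v 1 * x + cf v 2 * y + cf v 3 * x ^+ 2 + cf v 4 * x * y + cf v 5 * y ^+ 2.
Definition Qf (v : qvf) (x y : C) : C :=
  cf v 6 + cf v 7 * x + cf v 8 * y + cf v 9 * x ^+ 2 + cf v 10 * x * y + cf v 11 * y ^+ 2.

Definition px (z : 'cV[C]_2) : C := z ord0 ord0.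
Definition py (z : 'cV[C]_2) : C := z ord_max ord0.

Definition vfe (v : qvf) (z : 'cV[C]_2) : 'cV[C]_2 :=
  \col_(i < 2) (if i == ord0 then Pf v (px z) (py z) else Qf v (px z) (py z)).

Definition jac (v : qvf) (z : 'cV[C]_2) : 'M[C]_2 :=
  let x := px z in let y := py z in
  \matrix_(i < 2, j < 2)
    if i == ord0 then
      (if j == ord0 then cf v 1 + 2%:R * cf v 3 * x + cf v 4 * y
                    else cf v 2 + cf v 4 * x + 2%:R * cf v 5 * y)
    else
      (if j == ord0 then cf v 7 + 2%:R * cf v 9 * x + cf v 10 * y
                    else cf v 8 + cf v 10 * x + 2%:R * cf v 11 * y).

Definition singular (v : qvf) (z : 'cV[C]_2) : Prop := vfe v z = 0.
Definition nondegenerate (v : qvf) (z : 'cV[C]_2) : bool := \det (jac v z) != 0.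
Definition spectrum (v : qvf) (z : 'cV[C]_2) : C * C := (\tr (jac v z), \det (jac v z)).

Definition enum_sing (v : qvf) (s : seq 'cV[C]_2) : Prop :=
  uniq s /\ forall z, z \in s <-> singular v z.

Definition four_nondeg_sing (v : qvf) : Prop :=
  exists s, [/\ enum_sing v s, size s = 4%N & all (nondegenerate v) s].

Definition same_spectra (v w : qvf) : Prop :=
  exists sv sw, [/\ enum_sing v sv, enum_sing w sw &
                    perm_eq (map (spectrum v) sv) (map (spectrum w) sw)].

Definition pinf (v : qvf) : {poly C} := (cf v 3)%:P + cf v 4 *: 'X + cf v 5 *: 'X^2.
Definition qinf (v : qvf) : {poly C} := (cf v 9)%:P + cf v 10 *: 'X + cf v 11 *: 'X^2.
Definition cubinf (v : qvf) : {poly C} := qinf v - 'X * pinf v.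

(* residue of the rational function N/D at a simple root a of D *)
Definition res_simple (N D : {poly C}) (a : C) : C := N.[a] / (D^`()).[a].

(* mu is the (ordered) triple of characteristic numbers at infinity of v,
   defined when q - t p has three distinct roots;
   mu_j = Res_{w = w_j} R(w), R = -p / (q - t p) *)
Definition char_inf (v : qvf) (mu : seq C) : Prop :=
  cubinf v != 0 /\
  exists w1 w2 w3 : C,
    [/\ uniq [:: w1; w2; w3], all (root (cubinf v)) [:: w1; w2; w3] &
        mu = map (res_simple (- pinf v) (cubinf v)) [:: w1; w2; w3]].

Definition same_char_inf (v w : qvf) : Prop :=
  exists muv muw, [/\ char_inf v muv, char_inf w muw & perm_eq muv muw].

(* w(x) = DT . v(T^{-1} x) with T(z) = A z + b, A invertible *)
Definition affine_equiv (v w : qvf) : Prop :=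
  exists (A : 'M[C]_2) (b : 'cV[C]_2),
    A \in unitmx /\ forall x, vfe w x = A *m vfe v (invmx A *m (x - b)).

End QVF.

(* Main.v *)
(* Normalise three of the singular points by an affine map. The determinants at
   the singular points then fix the position of the fourth one, so v and w may be
   assumed to share their singular points; the conics through them form a pencil,
   hence w = M v for a matrix M, and det M = 1. Equality of the traces says that
   div((M - 1) v) = 0 identically, and generically such matrices are the multiples
   of a single matrix N, polynomial in the coefficients of v. The condition
   det(1 + s N) = 1 leaves M = 1 and, by Cayley-Hamilton, the "twin"
   M = - N^2 / det N. The product of the characteristic numbers at infinity is
   - Res(P_2, Q_2) / Disc(q - t p); the resultant is the same for v and its twin,
   and the Zariski-open condition is that N is invertible, the resultant nonzero
   and the discriminants of v and of its twin distinct. *)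
Require Import Defs.
From HB Require Import structures.
From mathcomp Require Import all_boot all_order all_algebra.
From mathcomp Require Import ring.

Set Implicit Arguments. Unset Strict Implicit. Unset Printing Implicit Defensive.
Import Order.TTheory GRing.Theory Num.Theory.
Local Open Scope ring_scope.

Section QuadraticFields.
Variable C : numClosedFieldType.
Implicit Types (v w : qvf C) (z c : 'cV[C]_2) (M N L : 'M[C]_2).

Local Notation i0 := (ord0 : 'I_2).
Local Notation i1 := (ord_max : 'I_2).

(** * Coordinates for vectors and matrices of size two *)

Lemma ord2P (P : 'I_2 -> Prop) : P i0 -> P i1 -> forall i, P i.
Proof.
move=> h0 h1 [[|[|k]] hk] //.
- by have -> : Ordinal hk = i0 by apply/val_inj.
- by have -> : Ordinal hk = i1 by apply/val_inj.
Qed.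

Lemma big_ord2 (F : 'I_2 -> C) : \sum_(i < 2) F i = F i0 + F i1.
Proof. by rewrite big_ord_recr big_ord1 /=; congr (F _ + F _); apply/val_inj. Qed.

Lemma mx2P M N :
  M i0 i0 = N i0 i0 -> M i0 i1 = N i0 i1 -> M i1 i0 = N i1 i0 ->
  M i1 i1 = N i1 i1 -> M = N.
Proof. by move=> *; apply/matrixP; elim/ord2P; elim/ord2P. Qed.

Lemma cv2P (x y : 'cV[C]_2) : px x = px y -> py x = py y -> x = y.
Proof.
by move=> h0 h1; apply/matrixP; elim/ord2P=> j; rewrite (ord1 j).
Qed.

Lemma mulmx2E m (M : 'M[C]_2) (A : 'M[C]_(2, m)) i j :
  (M *m A) i j = M i i0 * A i0 j + M i i1 * A i1 j.
Proof. by rewrite mxE big_ord2. Qed.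

Lemma tr2E M : \tr M = M i0 i0 + M i1 i1.
Proof. by rewrite /mxtrace big_ord2. Qed.

Lemma det2E M : \det M = M i0 i0 * M i1 i1 - M i0 i1 * M i1 i0.
Proof.
rewrite (expand_det_row M i0) big_ord2 /cofactor !det_mx11 !mxE /=.
rewrite expr0 expr1 mul1r mulN1r mulrN.
congr (_ * M _ _ - _ * M _ _); exact/val_inj.
Qed.

Definition cv2 (x y : C) : 'cV[C]_2 := \col_i (if i == i0 then x else y).
Definition mx2 (x y z t : C) : 'M[C]_2 :=
  \matrix_(i, j) if i == i0 then (if j == i0 then x else y)
                 else (if j == i0 then z else t).

Lemma px_cv2 x y : px (cv2 x y) = x. Proof. by rewrite /px mxE. Qed.
Lemma py_cv2 x y : py (cv2 x y) = y. Proof. by rewrite /py mxE. Qed.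
Lemma pxD z c : px (z + c) = px z + px c. Proof. by rewrite /px mxE. Qed.
Lemma pyD z c : py (z + c) = py z + py c. Proof. by rewrite /py mxE. Qed.
Lemma pxM M z : px (M *m z) = M i0 i0 * px z + M i0 i1 * py z.
Proof. by rewrite /px mulmx2E. Qed.
Lemma pyM M z : py (M *m z) = M i1 i0 * px z + M i1 i1 * py z.
Proof. by rewrite /py mulmx2E. Qed.

Lemma px_vfe v z : px (vfe v z) = Pf v (px z) (py z).
Proof. by rewrite /px /vfe mxE. Qed.
Lemma py_vfe v z : py (vfe v z) = Qf v (px z) (py z).
Proof. by rewrite /py /vfe mxE. Qed.

Definition coordE := (px_vfe, py_vfe, px_cv2, py_cv2, pxD, pyD, pxM, pyM).

Lemma singularE v z :
  singular v z <-> Pf v (px z) (py z) = 0 /\ Qf v (px z) (py z) = 0.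
Proof.
rewrite -px_vfe -py_vfe; split=> [-> | [h0 h1]]; first by rewrite /px /py !mxE.
by apply: cv2P; rewrite ?h0 ?h1 /px /py mxE.
Qed.

Lemma jacE v z :
  jac v z = mx2 (cf v 1 + 2%:R * cf v 3 * px z + cf v 4 * py z)
                (cf v 2 + cf v 4 * px z + 2%:R * cf v 5 * py z)
                (cf v 7 + 2%:R * cf v 9 * px z + cf v 10 * py z)
                (cf v 8 + cf v 10 * px z + 2%:R * cf v 11 * py z).
Proof. by []. Qed.

(** * Left multiplication and affine changes of variables on coefficients *)

Definition mkqvf (s : seq C) : qvf C := fun i => nth 0 s i.

Lemma cf_mkqvf s k : (k < 12)%N -> cf (mkqvf s) k = nth 0 s k.
Proof. by move=> hk; rewrite /cf /mkqvf inordK. Qed.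

(** Fields are functions on ['I_12]; agreement of the twelve coefficients stands in for their
    equality. *)
Definition eqv v w := forall k, (k < 12)%N -> cf v k = cf w k.

Definition lmulq M v : qvf C :=
  mkqvf ([seq M i0 i0 * cf v k + M i0 i1 * cf v (6 + k) | k <- iota 0 6] ++
         [seq M i1 i0 * cf v k + M i1 i1 * cf v (6 + k) | k <- iota 0 6]).

(** [f k] lists the coefficients, after the substitution [z -> L z + c], of the component stored
    from index [k]: [P] for 0, [Q] for 6. *)
Definition precomp v L c : qvf C :=
  let: (r, s, t, u) := (L i0 i0, L i0 i1, L i1 i0, L i1 i1) in
  let: (a, b) := (px c, py c) in
  let q k := cf v k in
  let f k := [:: q k + q (1+k)%N * a + q (2+k)%N * b + q (3+k)%N * a ^+ 2
                   + q (4+k)%N * a * b + q (5+k)%N * b ^+ 2;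
     q (1+k)%N * r + q (2+k)%N * t + 2%:R * q (3+k)%N * a * r
       + q (4+k)%N * (a * t + b * r) + 2%:R * q (5+k)%N * b * t;
     q (1+k)%N * s + q (2+k)%N * u + 2%:R * q (3+k)%N * a * s
       + q (4+k)%N * (a * u + b * s) + 2%:R * q (5+k)%N * b * u;
     q (3+k)%N * r ^+ 2 + q (4+k)%N * r * t + q (5+k)%N * t ^+ 2;
     2%:R * q (3+k)%N * r * s + q (4+k)%N * (r * u + s * t) + 2%:R * q (5+k)%N * t * u;
     q (3+k)%N * s ^+ 2 + q (4+k)%N * s * u + q (5+k)%N * u ^+ 2] in
  mkqvf (f 0%N ++ f 6%N).

(** This is [v] written in the affine coordinate [z] in which the old point is [L z + c]. *)
Definition pullback v L c := lmulq (invmx L) (precomp v L c).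

Lemma vfe_lmulq M v z : vfe (lmulq M v) z = M *m vfe v z.
Proof.
apply: cv2P; rewrite !coordE /Pf /Qf !cf_mkqvf //=; ring.
Qed.

Lemma jac_lmulq M v z : jac (lmulq M v) z = M *m jac v z.
Proof. apply: mx2P; rewrite mulmx2E !jacE !mxE /= !cf_mkqvf //=; ring. Qed.

Lemma vfe_precomp v L c z : vfe (precomp v L c) z = vfe v (L *m z + c).
Proof.
apply: cv2P; rewrite !coordE /Pf /Qf !cf_mkqvf //= ?coordE; ring.
Qed.

Lemma jac_precomp v L c z : jac (precomp v L c) z = jac v (L *m z + c) *m L.
Proof.
apply: mx2P; rewrite mulmx2E !jacE !mxE /= !cf_mkqvf //= ?coordE; ring.
Qed.

Lemma vfe_pullback v L c z : vfe (pullback v L c) z = invmx L *m vfe v (L *m z + c).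
Proof. by rewrite vfe_lmulq vfe_precomp. Qed.

(** The Jacobian becomes its conjugate [L^-1 J L], with the same trace and determinant. *)
Lemma spectrum_pullback v L c z :
  L \in unitmx -> spectrum (pullback v L c) z = spectrum v (L *m z + c).
Proof.
move=> uL; rewrite /spectrum jac_lmulq jac_precomp.
rewrite mxtrace_mulC -mulmxA mulmxV // mulmx1; congr (_, _).
rewrite !det_mulmx det_inv mulrCA mulVr ?mulr1 //; by rewrite -unitmxE.
Qed.

Lemma singular_pullback v L c z :
  singular v (L *m z + c) -> singular (pullback v L c) z.
Proof. by rewrite /singular vfe_pullback => ->; rewrite mulmx0. Qed.

Lemma lmulqM M N v : eqv (lmulq (M *m N) v) (lmulq M (lmulq N v)).
Proof.
move=> k hk; do 12?[case: k hk => [|k] hk]; rewrite !cf_mkqvf //= ?cf_mkqvf //= !mulmx2E; ring.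
Qed.

Lemma eqv_lmulq M v w : eqv v w -> eqv (lmulq M v) (lmulq M w).
Proof.
move=> e k hk; do 12?[case: k hk => [|k] hk]; rewrite !cf_mkqvf //= !e //.
Qed.

Lemma eqv_sym v w : eqv v w -> eqv w v.
Proof. by move=> e k hk; rewrite e. Qed.
Lemma eqv_trans v w u : eqv v w -> eqv w u -> eqv v u.
Proof. by move=> e f k hk; rewrite e ?f. Qed.

Lemma lmul1q v : eqv (lmulq 1%:M v) v.
Proof.
move=> k hk; do 12?[case: k hk => [|k] hk] => //; rewrite cf_mkqvf //= !mxE /=;
  by rewrite ?mulr1n ?mulr0n ?mul1r ?mul0r ?addr0 ?add0r.
Qed.

Lemma precomp_lmulq M v L c : eqv (precomp (lmulq M v) L c) (lmulq M (precomp v L c)).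
Proof.
move=> k hk; do 12?[case: k hk => [|k] hk]; rewrite !cf_mkqvf //= ?cf_mkqvf //=; ring.
Qed.

Lemma eqv_vfe v w z : eqv v w -> vfe v z = vfe w z.
Proof.
by move=> e; apply: cv2P; rewrite !coordE /Pf /Qf !e.
Qed.

Lemma eqv_spectrum v w z : eqv v w -> spectrum v z = spectrum w z.
Proof. by move=> e; rewrite /spectrum !jacE !e. Qed.

(** Precomposition commutes with left multiplication, and [L^-1 (L M L^-1) = M L^-1]. *)
Lemma pullback_conj M v L c : L \in unitmx ->
  eqv (pullback (lmulq (L *m M *m invmx L) v) L c) (lmulq M (pullback v L c)).
Proof.
move=> uL; apply: eqv_trans (eqv_lmulq _ (precomp_lmulq _ _ _ _)) _.
apply: eqv_trans (eqv_sym (lmulqM _ _ _)) _.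
by rewrite !mulmxA mulVmx // mul1mx; apply: lmulqM.
Qed.

(** * Discriminant, resultant and characteristic numbers at infinity *)

Definition cubic_disc (a b c d : C) : C :=
  b ^+ 2 * c ^+ 2 - 4%:R * a * c ^+ 3 - 4%:R * b ^+ 3 * d
  - 27%:R * a ^+ 2 * d ^+ 2 + 18%:R * a * b * c * d.

Definition quad_res (p0 p1 p2 q0 q1 q2 : C) : C :=
  (p0 * q2 - p2 * q0) ^+ 2 - (p0 * q1 - p1 * q0) * (p1 * q2 - p2 * q1).

(** The discriminant of [q - t p] in formal degree three, that is, of the binary cubic
    [x Q_2 - y P_2]. *)
Definition disc_inf v :=
  cubic_disc (- cf v 5) (cf v 11 - cf v 4) (cf v 10 - cf v 3) (cf v 9).

Definition res_inf v :=
  quad_res (cf v 3) (cf v 4) (cf v 5) (cf v 9) (cf v 10) (cf v 11).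

Lemma eqv_disc_inf v w : eqv v w -> disc_inf v = disc_inf w.
Proof. by move=> e; rewrite /disc_inf !e. Qed.

Lemma eqv_res_inf v w : eqv v w -> res_inf v = res_inf w.
Proof. by move=> e; rewrite /res_inf !e. Qed.

Lemma res_inf_lmulq M v : res_inf (lmulq M v) = \det M ^+ 2 * res_inf v.
Proof. rewrite /res_inf /quad_res !cf_mkqvf //= det2E; ring. Qed.

Lemma res_inf_precomp v L c : res_inf (precomp v L c) = \det L ^+ 4 * res_inf v.
Proof. rewrite /res_inf /quad_res !cf_mkqvf //= det2E; ring. Qed.

Lemma res_inf_pullback v L c :
  L \in unitmx -> res_inf (pullback v L c) = \det L ^+ 2 * res_inf v.
Proof.
rewrite unitmxE => uL.
rewrite res_inf_lmulq res_inf_precomp det_inv mulrA; congr (_ * _).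
rewrite -[4%N]/(2 + 2)%N exprD mulrA -exprMn mulVr // expr1n mul1r //.
Qed.

(** The new coefficients are those of [a y^3 + b y^2 x + c y x^2 + d x^3] after [x -> r x + s y],
    [y -> t x + u y]; the discriminant is an invariant of weight 6. *)
Lemma cubic_disc_subst (a b c d r s t u : C) :
  cubic_disc (a * u ^+ 3 + b * u ^+ 2 * s + c * u * s ^+ 2 + d * s ^+ 3)
    (3%:R * a * t * u ^+ 2 + b * (2%:R * t * u * s + r * u ^+ 2)
      + c * (t * s ^+ 2 + 2%:R * u * r * s) + 3%:R * d * r * s ^+ 2)
    (3%:R * a * t ^+ 2 * u + b * (t ^+ 2 * s + 2%:R * t * u * r)
      + c * (u * r ^+ 2 + 2%:R * t * r * s) + 3%:R * d * r ^+ 2 * s)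
    (a * t ^+ 3 + b * t ^+ 2 * r + c * t * r ^+ 2 + d * r ^+ 3)
  = (r * u - s * t) ^+ 6 * cubic_disc a b c d.
Proof. rewrite /cubic_disc; ring. Qed.

Lemma cubic_discZ (k a b c d : C) :
  cubic_disc (k * a) (k * b) (k * c) (k * d) = k ^+ 4 * cubic_disc a b c d.
Proof. rewrite /cubic_disc; ring. Qed.

(* With [u = L^-1 v(L z + c)], the binary cubic [x ∧ u_2(x)] times [det L]
   equals [(L x) ∧ v_2(L x)]. *)
Lemma disc_inf_pullback v L c :
  L \in unitmx -> disc_inf (pullback v L c) = \det L ^+ 2 * disc_inf v.
Proof.
move=> uL; have dL : \det L != 0 by rewrite -unitfE -unitmxE.
(* Scaling the cubic by [\det L] contributes [\det L ^+ 4] and the substitution contributes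
   [\det L ^+ 6], which leaves [\det L ^+ 2]. *)
apply: (mulfI (expf_neq0 4 dL)); rewrite mulrA -exprD -cubic_discZ.
rewrite det2E -cubic_disc_subst.
have Ei : invmx L = (\det L)^-1 *: mx2 (L i1 i1) (- L i0 i1) (- L i1 i0) (L i0 i0).
  apply: (can_inj (mulKmx uL)); rewrite mulmxV // -scalemxAr; apply/esym.
  have -> : L *m mx2 (L i1 i1) (- L i0 i1) (- L i1 i0) (L i0 i0) = (\det L)%:M.
    by apply: mx2P; rewrite mulmx2E !mxE /= det2E ?mulr1n ?mulr0n; ring.
  by rewrite scale_scalar_mx mulVf.
move: dL; rewrite /pullback Ei det2E => dL.
by congr cubic_disc; rewrite !cf_mkqvf //= !mxE /= !cf_mkqvf //=; field.
Qed.

Lemma cubinf_horner v x : (cubinf v).[x] =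
  - cf v 5 * x ^+ 3 + (cf v 11 - cf v 4) * x ^+ 2 + (cf v 10 - cf v 3) * x + cf v 9.
Proof.
rewrite /cubinf /qinf /pinf.
rewrite !(hornerD, hornerN, hornerM, hornerC, hornerZ, hornerX, hornerXn, hornerMn).
ring.
Qed.

Lemma cubinf_deriv_horner v x : (cubinf v)^`().[x] =
  - 3%:R * cf v 5 * x ^+ 2 + 2%:R * (cf v 11 - cf v 4) * x + (cf v 10 - cf v 3).
Proof.
rewrite /cubinf /qinf /pinf !(derivD, derivN, derivM, derivC, derivZ, derivX, derivXn) /=.
rewrite !(hornerD, hornerN, hornerM, hornerC, hornerZ, hornerX, hornerXn, hornerMn).
ring.
Qed.

Lemma pinf_horner v x : (pinf v).[x] = cf v 3 + cf v 4 * x + cf v 5 * x ^+ 2.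
Proof. by rewrite /pinf !(hornerD, hornerC, hornerZ, hornerX, hornerXn). Qed.

(** First divided differences at the roots eliminate [d], a second one eliminates [c]. The leading
    coefficient [k] may vanish. *)
Lemma cubic_vieta (k b c d x y z : C) : uniq [:: x; y; z] ->
  (forall t, t \in [:: x; y; z] -> k * t ^+ 3 + b * t ^+ 2 + c * t + d = 0) ->
  [/\ b = - k * (x + y + z), c = k * (x * y + y * z + z * x)
    & d = - k * (x * y * z)].
Proof.
rewrite /= !inE negb_or andbT => /andP[/andP[nxy nxz] nyz] r.
have hx : k * x ^+ 3 + b * x ^+ 2 + c * x + d = 0 by apply: r; rewrite !inE eqxx.
have hy : k * y ^+ 3 + b * y ^+ 2 + c * y + d = 0.
  by apply: r; rewrite !inE eqxx orbT.
have hz : k * z ^+ 3 + b * z ^+ 2 + c * z + d = 0.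
  by apply: r; rewrite !inE eqxx !orbT.
have exy : k * (x ^+ 2 + x * y + y ^+ 2) + b * (x + y) + c = 0.
  have n : x - y != 0 by rewrite subr_eq0.
  by apply: (mulfI n); rewrite mulr0 -[RHS](subrr 0) -{1}hx -hy; ring.
have exz : k * (x ^+ 2 + x * z + z ^+ 2) + b * (x + z) + c = 0.
  have n : x - z != 0 by rewrite subr_eq0.
  by apply: (mulfI n); rewrite mulr0 -[RHS](subrr 0) -{1}hx -hz; ring.
have Eb : b = - k * (x + y + z).
  have n : y - z != 0 by rewrite subr_eq0.
  apply: (mulfI n); apply/eqP; rewrite -subr_eq0; apply/eqP.
  by rewrite -[RHS](subrr 0) -{1}exy -exz; ring.
have Ec : c = k * (x * y + y * z + z * x).
  by apply/eqP; rewrite -subr_eq0 -exy Eb; apply/eqP; ring.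
split=> //; apply/eqP; rewrite -subr_eq0 -hx Eb Ec; apply/eqP; ring.
Qed.

(** Up to sign and powers of the leading coefficient, the values of [p] at the roots of [q - t p]
    multiply to the resultant of [p] and [q], and the derivatives of [q - t p] there multiply to its
    discriminant. *)
Lemma prod_char_inf v mu : char_inf v mu ->
  disc_inf v != 0 /\ (\prod_(m <- mu) m) * disc_inf v = - res_inf v.
Proof.
case=> c0 [x [y [z [u /allP r ->]]]].
have [] := @cubic_vieta (- cf v 5) (cf v 11 - cf v 4) (cf v 10 - cf v 3) (cf v 9) x y z u.
  by move=> t /r /rootP; rewrite cubinf_horner.
rewrite opprK => e11 e10 e9.
(* Three distinct roots force degree three: with [cf v 5 = 0] the Vieta relations would make the
   whole cubic zero. *)
have nk : cf v 5 != 0.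
  apply: contra_neq c0 => k0; move: e11 e10 e9.
  rewrite k0 oppr0 !mul0r => /eqP; rewrite subr_eq0 => /eqP e11.
  move=> /eqP; rewrite subr_eq0 => /eqP e10 e9.
  by rewrite /cubinf /qinf /pinf k0 e11 e10 e9 -!mul_polyC; ring.
have {}e11 : cf v 11 = cf v 4 + cf v 5 * (x + y + z) by rewrite -e11; ring.
have {}e10 : cf v 10 = cf v 3 - cf v 5 * (x * y + y * z + z * x).
  by rewrite -mulNr -e10; ring.
move: u; rewrite /= !inE negb_or andbT => /andP[/andP[nxy nxz] nyz].
have dE : disc_inf v = cf v 5 ^+ 4 * ((x - y) * (x - z) * (y - z)) ^+ 2.
  by rewrite /disc_inf /cubic_disc e11 e10 e9; ring.
split.
  by rewrite dE mulf_neq0 ?expf_neq0 ?mulf_neq0 // subr_eq0.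
rewrite !big_cons big_nil mulr1 dE /res_simple !hornerN !cubinf_deriv_horner.
rewrite !pinf_horner /res_inf /quad_res e11 e10 e9.
have n1 : x - y != 0 by rewrite subr_eq0.
have n2 : x - z != 0 by rewrite subr_eq0.
have n3 : y - z != 0 by rewrite subr_eq0.
have -> : - 3%:R * cf v 5 * x ^+ 2 + 2%:R * (cf v 4 + cf v 5 * (x + y + z) - cf v 4) * x
   + (cf v 3 - cf v 5 * (x * y + y * z + z * x) - cf v 3) = - cf v 5 * ((x - y) * (x - z)).
  by ring.
have -> : - 3%:R * cf v 5 * y ^+ 2 + 2%:R * (cf v 4 + cf v 5 * (x + y + z) - cf v 4) * y
   + (cf v 3 - cf v 5 * (x * y + y * z + z * x) - cf v 3) = cf v 5 * ((x - y) * (y - z)).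
  by ring.
have -> : - 3%:R * cf v 5 * z ^+ 2 + 2%:R * (cf v 4 + cf v 5 * (x + y + z) - cf v 4) * z
   + (cf v 3 - cf v 5 * (x * y + y * z + z * x) - cf v 3) = - cf v 5 * ((x - z) * (y - z)).
  by ring.
by field; rewrite nk n1 n2 n3.
Qed.

(** * Three singular points as an affine frame *)

Lemma det_eq0_of_kernel M z : M *m z = 0 -> z != 0 -> \det M = 0.
Proof.
move=> Mz; apply: contra_neq_eq => dM.
have uM : M \in unitmx by rewrite unitmxE unitfE.
by rewrite -(mulKmx uM z) Mz mulmx0.
Qed.

(* On the line through three collinear zeros both components of the field are
   quadratic with three roots, so the derivative along the line vanishes. *)
Lemma collinear_degenerate v p1 h (t : C) : h != 0 -> t != 0 -> t != 1 ->
  singular v p1 -> singular v (p1 + h) -> singular v (p1 + t *: h) ->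
  \det (jac v p1) = 0.
Proof.
move=> h0 t0 t1 /singularE[P1 Q1] /singularE[P2 Q2] /singularE[P3 Q3].
apply: (@det_eq0_of_kernel _ h) => //.
have px0 : px (0 : 'cV[C]_2) = 0 by rewrite /px mxE.
have py0 : py (0 : 'cV[C]_2) = 0 by rewrite /py mxE.
have pxZ (k : C) (u : 'cV[C]_2) : px (k *: u) = k * px u by rewrite /px mxE.
have pyZ (k : C) (u : 'cV[C]_2) : py (k *: u) = k * py u by rewrite /py mxE.
have n : t * (t - 1) != 0 by rewrite mulf_neq0 // subr_eq0.
move: P2 Q2 P3 Q3; rewrite !coordE !pxZ !pyZ => P2 Q2 P3 Q3.
apply: cv2P; rewrite ?px0 ?py0 !coordE jacE !mxE /=; apply: (mulfI n); rewrite mulr0.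
- rewrite -[RHS](_ : t ^+ 2 * (Pf v (px p1 + px h) (py p1 + py h) - Pf v (px p1) (py p1))
     - (Pf v (px p1 + t * px h) (py p1 + t * py h) - Pf v (px p1) (py p1)) = 0).
    by rewrite /Pf; ring.
  by rewrite P1 P2 P3 !subr0 mulr0.
- rewrite -[RHS](_ : t ^+ 2 * (Qf v (px p1 + px h) (py p1 + py h) - Qf v (px p1) (py p1))
     - (Qf v (px p1 + t * px h) (py p1 + t * py h) - Qf v (px p1) (py p1)) = 0).
    by rewrite /Qf; ring.
  by rewrite Q1 Q2 Q3 !subr0 mulr0.
Qed.

(** The columns of [L] are [p2 - p1] and [p3 - p1]; if they were dependent, the three zeros would be
    collinear and [p1] degenerate. *)
Lemma singular_frame v p1 p2 p3 :
  uniq [:: p1; p2; p3] -> singular v p1 -> singular v p2 -> singular v p3 ->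
  Defs.nondegenerate v p1 ->
  exists L : 'M[C]_2, [/\ L \in unitmx, p1 = L *m cv2 0 0 + p1,
    p2 = L *m cv2 1 0 + p1 & p3 = L *m cv2 0 1 + p1].
Proof.
rewrite /= !inE negb_or andbT => /andP[/andP[n12 n13] n23] s1 s2 s3 nd.
set h := p2 - p1; set k := p3 - p1.
have h0 : h != 0 by rewrite subr_eq0 eq_sym.
exists (mx2 (px h) (px k) (py h) (py k)).
have e2 : p2 = h + p1 by rewrite subrK.
have e3 : p3 = k + p1 by rewrite subrK.
split; last 3 first.
- by apply: cv2P; rewrite !coordE !mulr0 !addr0 add0r.
- by rewrite [LHS]e2; apply: cv2P; rewrite !coordE !mxE /= !mulr0 !mulr1 addr0.
- by rewrite [LHS]e3; apply: cv2P; rewrite !coordE !mxE /= !mulr0 !mulr1 add0r.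
rewrite unitmxE unitfE; apply: contraNneq nd => d0.
rewrite det2E !mxE /= in d0.
move/eqP: d0; rewrite subr_eq0 => /eqP d0.
suff [t kE] : exists t, k = t *: h.
  apply/eqP; apply: (@collinear_degenerate v p1 h t) => //.
  - by apply: contraNneq n13 => t0; rewrite e3 kE t0 scale0r add0r.
  - by apply: contraNneq n23 => t1; rewrite e3 kE t1 scale1r -e2.
  - by rewrite addrC -e2.
  - by rewrite addrC -kE -e3.
have [x0|x0] := eqVneq (px h) 0.
  have y0 : py h != 0.
    apply: contra_neq h0 => y0; apply: cv2P; rewrite ?x0 ?y0 /px /py mxE //.
  exists (py k / py h); apply: cv2P; rewrite [RHS]mxE -/(px h) -/(py h) ?divfK //.
  rewrite x0 mulr0; move/eqP: d0; rewrite x0 mul0r eq_sym mulf_eq0 (negbTE y0) orbF.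
  by move/eqP.
exists (px k / px h); apply: cv2P; rewrite [RHS]mxE -/(px h) -/(py h) ?divfK //.
by rewrite mulrAC -d0 mulrC mulKf.
Qed.

(** * Fields vanishing at the standard frame and at a fourth point *)

Definition standard_zeros v a b :=
  [/\ singular v (cv2 0 0), singular v (cv2 1 0), singular v (cv2 0 1)
    & singular v (cv2 a b)].

Section Standard.
Variables (v : qvf C) (a b : C).
Hypothesis sv : standard_zeros v a b.

Lemma standard_coefs :
  [/\ cf v 0 = 0, cf v 1 = - cf v 3 & cf v 2 = - cf v 5] /\
  [/\ cf v 6 = 0, cf v 7 = - cf v 9 & cf v 8 = - cf v 11].
Proof.
case: sv => /singularE[P0 Q0] /singularE[P1 Q1] /singularE[P2 Q2] _.
move: P0 Q0 P1 Q1 P2 Q2; rewrite !coordE /Pf /Qf => P0 Q0 P1 Q1 P2 Q2.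
have E0 : cf v 0 = 0 by rewrite -P0; ring.
have E6 : cf v 6 = 0 by rewrite -Q0; ring.
split; split=> //; apply/eqP; rewrite -subr_eq0; apply/eqP.
- by rewrite -P1 E0; ring.
- by rewrite -P2 E0; ring.
- by rewrite -Q1 E6; ring.
- by rewrite -Q2 E6; ring.
Qed.

(** A conic through the three standard points is a combination of [x (x - 1)], [x y] and
    [y (y - 1)], here evaluated at [(a, b)]. *)
Lemma standard_conics :
  cf v 3 * (a * (a - 1)) + cf v 4 * (a * b) + cf v 5 * (b * (b - 1)) = 0 /\
  cf v 9 * (a * (a - 1)) + cf v 10 * (a * b) + cf v 11 * (b * (b - 1)) = 0.
Proof.
have [[E0 E1 E2] [E6 E7 E8]] := standard_coefs.
case: sv => _ _ _ /singularE[]; rewrite !coordE /Pf /Qf E0 E1 E2 E6 E7 E8 => P Q.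
by split; [rewrite -P | rewrite -Q]; ring.
Qed.

Lemma standard_dets :
  [/\ \det (jac v (cv2 0 0)) = cf v 3 * cf v 11 - cf v 5 * cf v 9,
      \det (jac v (cv2 1 0)) = (cf v 3 * cf v 10 - cf v 4 * cf v 9)
                               - (cf v 3 * cf v 11 - cf v 5 * cf v 9)
    & \det (jac v (cv2 0 1)) = (cf v 4 * cf v 11 - cf v 5 * cf v 10)
                               - (cf v 3 * cf v 11 - cf v 5 * cf v 9)].
Proof.
have [[E0 E1 E2] [E6 E7 E8]] := standard_coefs.
by split; rewrite det2E !jacE !mxE /= !coordE E1 E2 E7 E8; ring.
Qed.

Hypotheses (n1 : Defs.nondegenerate v (cv2 0 0)) (n2 : Defs.nondegenerate v (cv2 1 0))
  (u : uniq [:: cv2 0 0; cv2 1 0; cv2 0 1; cv2 a b]).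

(** A fourth point on a side line of the standard triangle would, by the conic relations, make the
    Jacobian singular at a vertex: the origin for [a = 0] or [b = 0], and [(1, 0)] for
    [a + b = 1]. *)
Lemma standard_general_position : [/\ a != 0, b != 0 & a + b != 1].
Proof.
have [c3 c9] := standard_conics.
have [d1 d2 d3] := standard_dets.
move: u; rewrite /= !inE !negb_or andbT => /andP[/and3P[_ _ n14] /andP[/andP[_ n24] n34]].
have a0 : a != 0.
  apply: contraNneq n1 => a0; rewrite d1.
  have m : b * (b - 1) != 0.
    rewrite mulf_neq0 ?subr_eq0 //.
      by apply: contraNneq n14 => b0; rewrite a0 b0.
    by apply: contraNneq n34 => b1; rewrite a0 b1.
  have -> : cf v 5 = 0 by apply: (mulIf m); rewrite mul0r -c3 a0; ring.
  have -> : cf v 11 = 0 by apply: (mulIf m); rewrite mul0r -c9 a0; ring.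
  by rewrite mulr0 mul0r subrr.
have b0 : b != 0.
  apply: contraNneq n1 => b0; rewrite d1.
  have m : a * (a - 1) != 0.
    rewrite mulf_neq0 ?subr_eq0 //.
    by apply: contraNneq n24 => a1; rewrite b0 a1.
  have -> : cf v 3 = 0 by apply: (mulIf m); rewrite mul0r -c3 b0; ring.
  have -> : cf v 9 = 0 by apply: (mulIf m); rewrite mul0r -c9 b0; ring.
  by rewrite mulr0 mul0r subrr.
split=> //; apply: contraNneq n2 => ab; rewrite d2.
have bE : b = 1 - a by rewrite -ab; ring.
have m : a * b != 0 by rewrite mulf_neq0.
have -> : cf v 4 = cf v 3 + cf v 5.
  by apply: (mulIf m); apply/eqP; rewrite -subr_eq0 -c3 bE; apply/eqP; ring.
have -> : cf v 10 = cf v 9 + cf v 11.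
  by apply: (mulIf m); apply/eqP; rewrite -subr_eq0 -c9 bE; apply/eqP; ring.
by apply/eqP; ring.
Qed.

(* The three 2x2 minors of the coefficients of the quadratic parts are
   [d2 + d1], [d1], [d3 + d1], and the two conics through [(a, b)] make them
   proportional to [b (b - 1)], [- a b], [a (a - 1)]; hence a linear system for
   [(a, b)]. *)
Lemma standard_fourth_point (d1 := \det (jac v (cv2 0 0)))
  (d2 := \det (jac v (cv2 1 0))) (d3 := \det (jac v (cv2 0 1)))
  (D := (d2 + d1) * (d3 + d1) - d1 ^+ 2) :
  [/\ D != 0, D * a = d1 * d3 & D * b = d1 * d2].
Proof.
have [c3 c9] := standard_conics.
have [e1 e2 e3] := standard_dets.
have [a0 b0 ab] := standard_general_position.
have X : (d2 + d1) * a + d1 * b = d1.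
  apply: (mulfI b0); apply/eqP; rewrite -subr_eq0 /d1 /d2 e1 e2.
  rewrite -[0](_ : cf v 3 * (cf v 9 * (a * (a - 1)) + cf v 10 * (a * b) + cf v 11 * (b * (b - 1)))
    - cf v 9 * (cf v 3 * (a * (a - 1)) + cf v 4 * (a * b) + cf v 5 * (b * (b - 1))) = 0).
    by apply/eqP; ring.
  by rewrite c3 c9 !mulr0 subrr.
have Y : (d3 + d1) * b + d1 * a = d1.
  apply: (mulfI a0); apply/eqP; rewrite -subr_eq0 /d1 /d3 e1 e3.
  rewrite -[0](_ : cf v 11 * (cf v 3 * (a * (a - 1)) + cf v 4 * (a * b) + cf v 5 * (b * (b - 1)))
    - cf v 5 * (cf v 9 * (a * (a - 1)) + cf v 10 * (a * b) + cf v 11 * (b * (b - 1))) = 0).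
    by apply/eqP; ring.
  by rewrite c3 c9 !mulr0 subrr.
have Xa : (d2 + d1) * a = d1 * (1 - b) by apply: (addIr (d1 * b)); rewrite X; ring.
have Yb : (d3 + d1) * b = d1 * (1 - a) by apply: (addIr (d1 * a)); rewrite Y; ring.
split.
(* By the two linear equations this quantity equals [D * (a * b)]. *)
- have : d1 ^+ 2 * (1 - (a + b)) != 0.
    by rewrite mulf_neq0 ?expf_neq0 // subr_eq0 eq_sym.
  apply: contraNneq => D0; apply/eqP.
  rewrite -[RHS](mul0r (a * b)) -D0.
  have -> : D * (a * b) = ((d2 + d1) * a) * ((d3 + d1) * b) - d1 ^+ 2 * a * b by rewrite /D; ring.
  by rewrite Xa Yb; ring.
- have -> : D * a = ((d2 + d1) * a) * (d3 + d1) - d1 ^+ 2 * a by rewrite /D; ring.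
  have -> : (d2 + d1) * a * (d3 + d1) = d1 * (d3 + d1) - d1 * ((d3 + d1) * b).
    by rewrite Xa; ring.
  by rewrite Yb; ring.
- have -> : D * b = ((d3 + d1) * b) * (d2 + d1) - d1 ^+ 2 * b by rewrite /D; ring.
  have -> : (d3 + d1) * b * (d2 + d1) = d1 * (d2 + d1) - d1 * ((d2 + d1) * a).
    by rewrite Yb; ring.
  by rewrite Xa; ring.
Qed.

End Standard.

(* The conics through four points in general position form a plane. *)
Lemma standard_pencil v w a b : standard_zeros v a b -> standard_zeros w a b ->
  a != 0 -> b != 0 -> Defs.nondegenerate v (cv2 0 0) ->
  exists M, eqv w (lmulq M v).
Proof.
move=> sv sw a0 b0 n1.
have [[v0 v1 v2] [v6 v7 v8]] := standard_coefs sv.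
have [[w0 w1 w2] [w6 w7 w8]] := standard_coefs sw.
have [c3 c9] := standard_conics sv; have [k3 k9] := standard_conics sw.
have [d1 _ _] := standard_dets sv.
have D0 : cf v 3 * cf v 11 - cf v 5 * cf v 9 != 0 by rewrite -d1.
have m : a * b != 0 by rewrite mulf_neq0.
(* Cramer's rule for the coefficients of [x^2] and [y^2]; those of [x y] then agree because the
   point [(a, b)] determines them from the other two. *)
exists ((cf v 3 * cf v 11 - cf v 5 * cf v 9)^-1 *:
  mx2 (cf w 3 * cf v 11 - cf w 5 * cf v 9) (cf w 5 * cf v 3 - cf w 3 * cf v 5)
      (cf w 9 * cf v 11 - cf w 11 * cf v 9) (cf w 11 * cf v 3 - cf w 9 * cf v 5)).
have sol x y t : x * (a * (a - 1)) + y * (a * b) + t * (b * (b - 1)) = 0 ->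
    y = - (x * (a - 1)) / b - (t * (b - 1)) / a.
  move=> h; apply: (mulIf m); apply/eqP; rewrite -subr_eq0 -h; apply/eqP; field.
  by rewrite a0 b0.
have {c3} v4 := sol _ _ _ c3; have {c9} v10 := sol _ _ _ c9.
have {k3} w4 := sol _ _ _ k3; have {k9} w10 := sol _ _ _ k9.
move=> k hk; do 12?[case: k hk => [|k] hk] => //; rewrite !cf_mkqvf //= !mxE /=;
  rewrite ?(v0, v1, v2, v6, v7, v8, w0, w1, w2, w6, w7, w8, v4, v10, w4, w10);
  by field; rewrite ?a0 ?b0 ?D0.
Qed.

(** * Divergence-free left multiples and the twin *)

Definition det3 (a b c d e f g h i : C) : C :=
  a * (e * i - f * h) - b * (d * i - f * g) + c * (d * h - e * g).

(* The matrices [M] for which the divergence of [M v] vanishes identically form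
   the kernel of a 3x4 linear system; its maximal minors, with signs, give a
   kernel vector. *)
Definition divfree_mx v : 'M[C]_2 := mx2
  (det3 (cf v 7) (cf v 2) (cf v 8)
        (2%:R * cf v 9) (cf v 4) (cf v 10)
        (cf v 10) (2%:R * cf v 5) (2%:R * cf v 11))
  (- det3 (cf v 1) (cf v 2) (cf v 8)
        (2%:R * cf v 3) (cf v 4) (cf v 10)
        (cf v 4) (2%:R * cf v 5) (2%:R * cf v 11))
  (det3 (cf v 1) (cf v 7) (cf v 8)
        (2%:R * cf v 3) (2%:R * cf v 9) (cf v 10)
        (cf v 4) (cf v 10) (2%:R * cf v 11))
  (- det3 (cf v 1) (cf v 7) (cf v 2)
        (2%:R * cf v 3) (2%:R * cf v 9) (cf v 4)
        (cf v 4) (cf v 10) (2%:R * cf v 5)).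

(** A determinant with the zero column [(r1, r2, r3)] and two columns of the system vanishes.
    Expanding that column as the combination given by [M] leaves, up to sign, [M_i N_j - M_j N_i],
    so [M] and [N] are proportional. *)
Lemma kernel_3x4 (a1 a2 a3 a4 b1 b2 b3 b4 c1 c2 c3 c4 : C) M
  (N := mx2 (det3 a2 a3 a4 b2 b3 b4 c2 c3 c4) (- det3 a1 a3 a4 b1 b3 b4 c1 c3 c4)
            (det3 a1 a2 a4 b1 b2 b4 c1 c2 c4) (- det3 a1 a2 a3 b1 b2 b3 c1 c2 c3)) :
  M i0 i0 * a1 + M i0 i1 * a2 + M i1 i0 * a3 + M i1 i1 * a4 = 0 ->
  M i0 i0 * b1 + M i0 i1 * b2 + M i1 i0 * b3 + M i1 i1 * b4 = 0 ->
  M i0 i0 * c1 + M i0 i1 * c2 + M i1 i0 * c3 + M i1 i1 * c4 = 0 ->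
  \det N != 0 -> exists s, M = s *: N.
Proof.
move Er1 : (_ + M i1 i1 * a4) => r1 r10; move Er2 : (_ + M i1 i1 * b4) => r2 r20.
move Er3 : (_ + M i1 i1 * c4) => r3 r30.
have z x y x' y' x'' y'' : det3 r1 x y r2 x' y' r3 x'' y'' = 0.
  by rewrite /det3 r10 r20 r30; ring.
have cross i j k l : M i j * N k l = M k l * N i j.
  apply/eqP; rewrite -subr_eq0; apply/eqP; move: i j k l.
  have e1 : M i0 i0 * N i0 i1 - M i0 i1 * N i0 i0 = 0.
    by rewrite -[RHS]oppr0 -(z a3 a4 b3 b4 c3 c4) -Er1 -Er2 -Er3 !mxE /= /det3; ring.
  have e2 : M i0 i0 * N i1 i0 - M i1 i0 * N i0 i0 = 0.
    by rewrite -(z a2 a4 b2 b4 c2 c4) -Er1 -Er2 -Er3 !mxE /= /det3; ring.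
  have e3 : M i0 i0 * N i1 i1 - M i1 i1 * N i0 i0 = 0.
    by rewrite -[RHS]oppr0 -(z a2 a3 b2 b3 c2 c3) -Er1 -Er2 -Er3 !mxE /= /det3; ring.
  have e4 : M i0 i1 * N i1 i0 - M i1 i0 * N i0 i1 = 0.
    by rewrite -[RHS]oppr0 -(z a1 a4 b1 b4 c1 c4) -Er1 -Er2 -Er3 !mxE /= /det3; ring.
  have e5 : M i0 i1 * N i1 i1 - M i1 i1 * N i0 i1 = 0.
    by rewrite -(z a1 a3 b1 b3 c1 c3) -Er1 -Er2 -Er3 !mxE /= /det3; ring.
  have e6 : M i1 i0 * N i1 i1 - M i1 i1 * N i1 i0 = 0.
    by rewrite -[RHS]oppr0 -(z a1 a2 b1 b2 c1 c2) -Er1 -Er2 -Er3 !mxE /= /det3; ring.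
  by do 4 elim/ord2P; rewrite ?subrr //; apply/eqP; rewrite -oppr_eq0 opprB ?e1 ?e2 ?e3 ?e4 ?e5 ?e6.
(* For [M = s N] the numerator, a mixed determinant, is [s] times [\det N]. *)
move=> dN; exists ((M i0 i0 * N i1 i1 - M i0 i1 * N i1 i0) / \det N).
have main i j : (M i0 i0 * N i1 i1 - M i0 i1 * N i1 i0) * N i j = M i j * \det N.
  rewrite det2E [RHS]mulrBr 2![in RHS]mulrA -(cross i0 i0 i j) -(cross i0 i1 i j).
  by ring.
by apply/matrixP=> i j; rewrite [RHS]mxE mulrAC main mulfK.
Qed.

(** The three equations are the vanishing of the constant, [x] and [y] coefficients of the
    divergence of [M v]. *)
Lemma divfree_mxP v M :
  M i0 i0 * cf v 1 + M i0 i1 * cf v 7 + M i1 i0 * cf v 2 + M i1 i1 * cf v 8 = 0 ->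
  M i0 i0 * (2%:R * cf v 3) + M i0 i1 * (2%:R * cf v 9) + M i1 i0 * cf v 4
    + M i1 i1 * cf v 10 = 0 ->
  M i0 i0 * cf v 4 + M i0 i1 * cf v 10 + M i1 i0 * (2%:R * cf v 5)
    + M i1 i1 * (2%:R * cf v 11) = 0 ->
  \det (divfree_mx v) != 0 -> exists s, M = s *: divfree_mx v.
Proof. exact: kernel_3x4. Qed.

(** Since [\det (1 + s N) = 1 + s \tr N + s^2 \det N], the nonzero solution is
    [s = - \tr N / \det N]; Cayley-Hamilton rewrites [1 + s N]. *)
Lemma unimodular_divfree N (s : C) : \det N != 0 -> s != 0 -> \det (1%:M + s *: N) = 1 ->
  1%:M + s *: N = - (\det N)^-1 *: (N *m N).
Proof.
move=> dN s0 d1.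
have sE : s * \det N = - \tr N.
  apply: (mulfI s0); apply: (addrI 1); rewrite mulrN -[in RHS]d1 !det2E tr2E !mxE /=.
  by rewrite ?mulr1n ?mulr0n; ring.
have -> : s = - \tr N / \det N by rewrite -sE mulfK.
move: dN; rewrite det2E tr2E => dN.
by apply: mx2P; rewrite !mxE !big_ord2 ?mulr1n ?mulr0n; field.
Qed.

Lemma disc_inf_lmulqZ (k : C) M v :
  disc_inf (lmulq (k *: M) v) = k ^+ 4 * disc_inf (lmulq M v).
Proof.
by rewrite /disc_inf -cubic_discZ; congr cubic_disc; rewrite !cf_mkqvf //= !mxE; ring.
Qed.

(* The last factor compares the discriminants of [v] and of its twin
   [- N^2 v / det N], cleared of denominators. *)
Definition generic_poly v : C :=
  res_inf v * \det (divfree_mx v) *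
  (disc_inf (lmulq (divfree_mx v *m divfree_mx v) v)
   - \det (divfree_mx v) ^+ 4 * disc_inf v).

Lemma subr_eq0_of_eq (x y : C) : x = y -> x - y = 0.
Proof. by move=> ->; rewrite subrr. Qed.

Lemma unimodular_twin v M : generic_poly v != 0 -> \det M = 1 ->
  (forall z, \tr (jac (lmulq M v) z) = \tr (jac v z)) ->
  disc_inf (lmulq M v) = disc_inf v -> M = 1%:M.
Proof.
rewrite /generic_poly !mulf_eq0 !negb_or => /andP[/andP[_ dN] nd] dM trM dd.
(* The divergence of [(M - 1) v] is affine: its value at the origin and its increments along the
   axes are its coefficients. *)
have f0 := subr_eq0_of_eq (trM (cv2 0 0)).
have f1 := congr2 (fun x y => x - y) (subr_eq0_of_eq (trM (cv2 1 0))) f0.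
have f2 := congr2 (fun x y => x - y) (subr_eq0_of_eq (trM (cv2 0 1))) f0.
have {f0 f1 f2 trM} [s sE] : exists s, M - 1%:M = s *: divfree_mx v.
  move: f0 f1 f2; rewrite !tr2E !jacE !mxE /= !coordE !cf_mkqvf //= subrr => f0 f1 f2.
  apply: divfree_mxP dN; rewrite !mxE ?mulr1n ?mulr0n /=.
  - by rewrite -[RHS]f0; ring.
  - by rewrite -[RHS]f1; ring.
  - by rewrite -[RHS]f2; ring.
have ME : M = 1%:M + s *: divfree_mx v by rewrite -sE addrC subrK.
have [s0|s0] := eqVneq s 0; first by rewrite ME s0 scale0r addr0.
(* Here [M] is the twin; equal discriminants contradict the last factor of [generic_poly] once the
   fourth power of [- (\det N)^-1] is cleared. *)
case/eqP: nd; rewrite -dd ME unimodular_divfree -?ME // disc_inf_lmulqZ.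
by rewrite exprNn -signr_odd expr0 mul1r mulrA -exprMn divff // expr1n mul1r subrr.
Qed.

(** * Matching the singular points and normalising both fields *)

Lemma jac_trace_frame v w L c : L \in unitmx ->
  (forall z, z \in [:: cv2 0 0; cv2 1 0; cv2 0 1] ->
     \tr (jac v (L *m z + c)) = \tr (jac w (L *m z + c))) ->
  forall z, \tr (jac v z) = \tr (jac w z).
Proof.
move=> uL h z.
have -> : z = L *m (invmx L *m (z - c)) + c by rewrite mulKVmx // subrK.
move: (invmx L *m _) => y.
have f0 := subr_eq0_of_eq (h (cv2 0 0) (mem_head _ _)).
have f1 : \tr (jac v (L *m cv2 1 0 + c)) - \tr (jac w (L *m cv2 1 0 + c)) = 0.
  by apply: subr_eq0_of_eq; apply: h; rewrite !inE eqxx orbT.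
have f2 : \tr (jac v (L *m cv2 0 1 + c)) - \tr (jac w (L *m cv2 0 1 + c)) = 0.
  by apply: subr_eq0_of_eq; apply: h; rewrite !inE eqxx !orbT.
apply/eqP; rewrite -subr_eq0; apply/eqP.
(* The trace is affine in the point; the weights are the barycentric coordinates of [y] in the
   standard triangle. *)
have -> : \tr (jac v (L *m y + c)) - \tr (jac w (L *m y + c)) =
    px y * (\tr (jac v (L *m cv2 1 0 + c)) - \tr (jac w (L *m cv2 1 0 + c)))
  + py y * (\tr (jac v (L *m cv2 0 1 + c)) - \tr (jac w (L *m cv2 0 1 + c)))
  + (1 - px y - py y) * (\tr (jac v (L *m cv2 0 0 + c)) - \tr (jac w (L *m cv2 0 0 + c))).
  by rewrite !tr2E !jacE !mxE /= !coordE; ring.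
by rewrite f0 f1 f2 !mulr0 !addr0.
Qed.

Lemma matched_singularities v w : four_nondeg_sing w -> same_spectra v w ->
  exists ps qs : seq 'cV[C]_2, [/\ size ps = 4%N, uniq ps, uniq qs,
    (forall z, z \in ps -> singular v z) /\
    (forall z, z \in qs -> singular w z /\ Defs.nondegenerate w z)
    & map (spectrum v) ps = map (spectrum w) qs].
Proof.
case=> s [[us hs] s4 /allP nds] [sv [sw [[uv hv] [uw hw] pe]]].
have pws : perm_eq sw s.
  by apply: uniq_perm => // z; apply/idP/idP => [/hw /hs | /hs /hw].
(* The index permutation [Is] reorders the zeros of [w] so that the spectra agree position by
   position. *)
have [Is pI eI] := perm_iotaP (0, 0) pe.
set qs := [seq nth 0 sw i | i <- Is].
have pq : perm_eq qs sw.
  have -> : sw = [seq nth 0 sw i | i <- iota 0 (size sw)].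
    by rewrite -/(mkseq _ _) mkseq_nth.
  by rewrite perm_map //; move: pI; rewrite size_map.
exists sv, qs; split=> //.
- by rewrite -(size_map (spectrum v)) (perm_size pe) size_map (perm_size pws).
- by rewrite (perm_uniq pq).
- split=> z; first by move/hv.
  rewrite (perm_mem pq) => zsw; split; first exact/hw.
  by apply: nds; rewrite -(perm_mem pws).
rewrite eI -map_comp; apply/eq_in_map => i; rewrite (perm_mem pI) mem_iota size_map.
by move=> /= hi; rewrite (nth_map 0).
Qed.

Definition frame a b : seq 'cV[C]_2 := [:: cv2 0 0; cv2 1 0; cv2 0 1; cv2 a b].

Lemma standardize v p1 p2 p3 p4 (ps := [:: p1; p2; p3; p4]) :
  uniq ps -> (forall z, z \in ps -> singular v z) -> Defs.nondegenerate v p1 ->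
  exists (L : 'M[C]_2) (a b : C), [/\ L \in unitmx,
    ps = [seq L *m z + p1 | z <- frame a b],
    standard_zeros (pullback v L p1) a b & uniq (frame a b)].
Proof.
move=> ups sps nd.
have u3 : uniq [:: p1; p2; p3].
  by have := ups; rewrite (_ : ps = [:: p1; p2; p3] ++ [:: p4]) // cat_uniq => /andP[].
have sg i : (i < 4)%N -> singular v (nth 0 ps i) by move=> hi; apply/sps/mem_nth.
have [L [uL e1 e2 e3]] := singular_frame u3 (sg 0%N isT) (sg 1%N isT) (sg 2%N isT) nd.
set y := invmx L *m (p4 - p1); exists L, (px y), (py y).
have psE : ps = [seq L *m z + p1 | z <- frame (px y) (py y)].
  congr [:: _; _; _; _] => //.
  have -> : cv2 (px y) (py y) = y by apply: cv2P; rewrite !coordE.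
  by rewrite mulKVmx // subrK.
have sz i : (i < 4)%N -> singular (pullback v L p1) (nth 0 (frame (px y) (py y)) i).
  move=> hi; apply: singular_pullback; rewrite -(nth_map 0 0 (fun z => L *m z + p1)) // -psE; exact: sg.
split=> //; first by split; [exact: (sz 0%N)|exact: (sz 1%N)|exact: (sz 2%N)|exact: (sz 3%N)].
by move: ups; rewrite psE => /map_uniq.
Qed.

Lemma same_spectra_twin v w : four_nondeg_sing w -> same_spectra v w ->
  exists (L L' M : 'M[C]_2) (c c' : 'cV[C]_2),
    [/\ L \in unitmx, L' \in unitmx, \det M = 1,
        eqv (pullback w L' c') (lmulq M (pullback v L c))
      & forall z, \tr (jac (lmulq (L *m M *m invmx L) v) z) = \tr (jac v z)].
Proof.
move=> hw hs.
have [[|p1 [|p2 [|p3 [|p4 [|? ?]]]]] [qs [// _ ups uqs [sps sqs] e]]] :=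
  matched_singularities hw hs.
move: qs uqs sqs e => [|q1 [|q2 [|q3 [|q4 [|? ?]]]]] // uqs sqs e.
(* Non-degeneracy is read off the second component of the spectrum, so it passes from [w] to [v]. *)
have ndp z : z \in [:: p1; p2; p3; p4] -> Defs.nondegenerate v z.
  move=> zp; have : spectrum v z \in map (spectrum w) [:: q1; q2; q3; q4].
    by rewrite -e map_f.
  case/mapP=> y /sqs[_ nd] [_ dE]; by rewrite /Defs.nondegenerate dE.
have [L [a [b [uL pE sv uf]]]] := standardize ups sps (ndp _ (mem_head _ _)).
have [L' [a' [b' [uL' qE sw uf']]]] :=
  standardize uqs (fun z hz => (sqs z hz).1) (sqs _ (mem_head _ _)).2.
have spv : map (spectrum (pullback v L p1)) (frame a b) = map (spectrum v) [:: p1; p2; p3; p4].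
  by rewrite pE -map_comp; apply: eq_map => z /=; rewrite spectrum_pullback.
have spw : map (spectrum (pullback w L' q1)) (frame a' b') = map (spectrum w) [:: q1; q2; q3; q4].
  by rewrite qE -map_comp; apply: eq_map => z /=; rewrite spectrum_pullback.
have ndv z : z \in frame a b -> Defs.nondegenerate (pullback v L p1) z.
  move=> zf; have : spectrum (pullback v L p1) z \in map (spectrum v) [:: p1; p2; p3; p4].
    by rewrite -spv map_f.
  case/mapP=> y /ndp nd [_ dE]; by rewrite /Defs.nondegenerate dE.
have ndw z : z \in frame a' b' -> Defs.nondegenerate (pullback w L' q1) z.
  move=> zf; have : spectrum (pullback w L' q1) z \in map (spectrum w) [:: q1; q2; q3; q4].
    by rewrite -spw map_f.
  case/mapP=> y /sqs[_ nd] [_ dE]; by rewrite /Defs.nondegenerate dE.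
have esp : map (spectrum (pullback v L p1)) (frame a b) =
           map (spectrum (pullback w L' q1)) (frame a' b') by rewrite spv spw.
case: (esp) => [t1 d1 t2 d2 t3 d3 _ _].
have in1 x y : cv2 0 0 \in frame x y by rewrite !inE eqxx.
have in2 x y : cv2 1 0 \in frame x y by rewrite !inE eqxx orbT.
have in3 x y : cv2 0 1 \in frame x y by rewrite !inE eqxx !orbT.
have [D0 Da Db] := standard_fourth_point sv (ndv _ (in1 _ _)) (ndv _ (in2 _ _)) uf.
have [a0 b0 _] := standard_general_position sv (ndv _ (in1 _ _)) (ndv _ (in2 _ _)) uf.
have [_ Da' Db'] := standard_fourth_point sw (ndw _ (in1 _ _)) (ndw _ (in2 _ _)) uf'.
(* Both fourth points now solve the same invertible system, hence coincide. *)
rewrite -!d1 -!d2 -!d3 -Da -Db in Da' Db'.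
have {Da'} ea := mulfI D0 Da'; have {Db'} eb := mulfI D0 Db'.
rewrite ea eb in sw.
have [M eM] := standard_pencil sv sw a0 b0 (ndv _ (in1 _ _)).
exists L, L', M, p1, q1; split=> //.
(* The Jacobian determinants at the origin agree and are nonzero, which forces [\det M = 1]. *)
- have /esym := d1; have [_ ->] := eqv_spectrum (cv2 0 0) eM.
  rewrite jac_lmulq det_mulmx => h.
  by apply: (mulIf (ndv _ (in1 _ _))); rewrite mul1r.
(* The pullback of [L M L^-1 v] is that of [w], so its traces agree with those of [v] at three frame
   points, hence everywhere. *)
have eu := eqv_trans (pullback_conj M v p1 uL) (eqv_sym eM).
have tr_pull u z : \tr (jac u (L *m z + p1)) = \tr (jac (pullback u L p1) z).
  by have [-> _] := spectrum_pullback u p1 z uL.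
apply: (jac_trace_frame uL (c := p1)) => z.
rewrite !tr_pull; have [-> _] := eqv_spectrum z eu.
by rewrite !inE => /or3P[] /eqP->.
Qed.

(** * Affine equivalence of generic fields *)

Lemma affine_equiv_pullback v w L c L' c' : L \in unitmx -> L' \in unitmx ->
  eqv (pullback w L' c') (pullback v L c) -> affine_equiv v w.
Proof.
(* The affine map sending [L y + c] to [L' y + c']. *)
move=> uL uL' e; exists (L' *m invmx L), (c' - L' *m invmx L *m c).
split; first by rewrite unitmx_mul uL' unitmx_inv.
move=> x; set y := invmx L' *m (x - c').
have -> : x = L' *m y + c' by rewrite mulKVmx // subrK.
have -> : invmx (L' *m invmx L) *m (L' *m y + c' - (c' - L' *m invmx L *m c)) = L *m y + c.
  apply: (can_inj (mulKmx (_ : L' *m invmx L \in unitmx))).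
    by rewrite unitmx_mul uL' unitmx_inv.
  rewrite mulKVmx ?unitmx_mul ?uL' ?unitmx_inv // mulmxDr.
  by rewrite -(mulmxA L' _ (L *m y)) mulKmx // opprB addrACA subrr addr0.
apply: (can_inj (mulKmx (_ : invmx L' \in unitmx))); first by rewrite unitmx_inv.
by rewrite -vfe_pullback (eqv_vfe _ e) vfe_pullback -(mulmxA L') mulKmx.
Qed.

(** Resultant and discriminant scale alike under pullback. As [\det M = 1] preserves the resultant,
    the common product of characteristic numbers makes the discriminants of [v] and [L M L^-1 v]
    equal, which excludes the twin. *)
Lemma generic_affine_equiv v w : generic_poly v != 0 ->
  four_nondeg_sing w -> same_spectra v w -> same_char_inf v w -> affine_equiv v w.
Proof.
move=> gv hw hs [mv [mw [/prod_char_inf[dv0 rv] /prod_char_inf[dw0 rw] pm]]].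
have [L [L' [M [c [c' [uL uL' dM e tr]]]]]] := same_spectra_twin hw hs.
have r0 : res_inf v != 0 by move: gv; rewrite /generic_poly !mulf_eq0 !negb_or => /andP[/andP[]].
have L0 : \det L ^+ 2 != 0 by rewrite expf_neq0 // -unitfE -unitmxE.
have L0' : \det L' ^+ 2 != 0 by rewrite expf_neq0 // -unitfE -unitmxE.
have Er := eqv_res_inf e.
rewrite res_inf_lmulq dM expr1n mul1r !res_inf_pullback // in Er.
have eu := eqv_trans (pullback_conj M v c uL) (eqv_sym e).
have Ed := eqv_disc_inf eu; rewrite !disc_inf_pullback // in Ed.
have dE : disc_inf (lmulq (L *m M *m invmx L) v) = disc_inf v.
  apply: (mulfI L0); rewrite Ed.
  (* The product of the characteristic numbers is nonzero because the resultant of [v] is, so it can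
     be cancelled. *)
  have P0 : \prod_(m <- mv) m != 0.
    by apply: contra_neq r0 => p0; rewrite -[LHS]opprK -rv p0 mul0r oppr0.
  apply: (mulfI P0); rewrite mulrCA [RHS]mulrCA rv (perm_big _ pm) /= rw.
  by rewrite !mulrN Er.
have N1 : L *m M *m invmx L = 1%:M.
  apply: unimodular_twin tr dE => //.
  by rewrite !det_mulmx dM mulr1 -det_mulmx mulmxV // det1.
have M1 : M = 1%:M.
  rewrite -[M](mulKmx uL) -[L *m M](mulmxKV uL) N1 mul1mx mulVmx //.
apply: (affine_equiv_pullback uL uL').
by apply: eqv_trans e _; rewrite M1; apply: lmul1q.
Qed.

(** * Polynomiality and nonemptiness of the generic condition *)

Definition polyfun (f : qvf C -> C) := exists p : mpoly C 12, forall v, meval v p = f v.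

Lemma polyfun_eq f g : (forall v, f v = g v) -> polyfun f -> polyfun g.
Proof. by move=> e [p pE]; exists p => v; rewrite pE. Qed.

Lemma polyfun_const x : polyfun (fun=> x).
Proof. by exists (MConst _ x). Qed.

Lemma polyfun_cf k : polyfun (fun v => cf v k).
Proof. by exists (MVar _ (inord k)). Qed.

Lemma polyfunD f g : polyfun f -> polyfun g -> polyfun (fun v => f v + g v).
Proof. by move=> [p pE] [q qE]; exists (MAdd p q) => v /=; rewrite pE qE. Qed.

Lemma polyfunM f g : polyfun f -> polyfun g -> polyfun (fun v => f v * g v).
Proof. by move=> [p pE] [q qE]; exists (MMul p q) => v /=; rewrite pE qE. Qed.

Lemma polyfunN f : polyfun f -> polyfun (fun v => - f v).
Proof.
move=> pf; apply: polyfun_eq (polyfunM (polyfun_const (-1)) pf) => v.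
by rewrite mulN1r.
Qed.

Lemma polyfunX n f : polyfun f -> polyfun (fun v => f v ^+ n).
Proof.
move=> pf; elim: n => [|n IHn]; first exact: polyfun_const.
by apply: polyfun_eq (polyfunM pf IHn) => v; rewrite exprS.
Qed.

Ltac solve_polyfun := repeat first [ assumption | exact: polyfun_cf | apply: polyfunD
  | apply: polyfunN | apply: polyfunX | apply: polyfunM | exact: polyfun_const ].

Lemma polyfun_det3 f1 f2 f3 g1 g2 g3 h1 h2 h3 :
  polyfun f1 -> polyfun f2 -> polyfun f3 -> polyfun g1 -> polyfun g2 -> polyfun g3 ->
  polyfun h1 -> polyfun h2 -> polyfun h3 ->
  polyfun (fun v => det3 (f1 v) (f2 v) (f3 v) (g1 v) (g2 v) (g3 v) (h1 v) (h2 v) (h3 v)).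
Proof. by move=> *; rewrite /det3; solve_polyfun. Qed.

Lemma polyfun_cubic_disc f g h k : polyfun f -> polyfun g -> polyfun h -> polyfun k ->
  polyfun (fun v => cubic_disc (f v) (g v) (h v) (k v)).
Proof. by move=> *; rewrite /cubic_disc; solve_polyfun. Qed.

Lemma polyfun_divfree_mx i j : polyfun (fun v => divfree_mx v i j).
Proof.
move: i j; do 2 elim/ord2P; apply: polyfun_eq => [v|]; try (rewrite mxE /=; reflexivity).
- by apply: polyfun_det3; solve_polyfun.
- by apply: polyfunN; apply: polyfun_det3; solve_polyfun.
- by apply: polyfun_det3; solve_polyfun.
- by apply: polyfunN; apply: polyfun_det3; solve_polyfun.
Qed.

Lemma polyfun_generic : polyfun generic_poly.
Proof.
have pN := polyfun_divfree_mx.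
have pd : polyfun (fun v => \det (divfree_mx v)).
  apply: polyfun_eq (fun v => esym (det2E _)) _; solve_polyfun; exact: pN.
have pNN i j : polyfun (fun v => (divfree_mx v *m divfree_mx v) i j).
  apply: polyfun_eq (fun v => esym (mulmx2E _ _ _ _)) _; solve_polyfun; exact: pN.
have pl k : (k < 12)%N ->
    polyfun (fun v => cf (lmulq (divfree_mx v *m divfree_mx v) v) k).
  (* Abstracting the matrix square to [K] leaves only the polynomiality of its entries. *)
  move: pNN; move: (fun v => divfree_mx v *m divfree_mx v) => K pK hk.
  apply: polyfun_eq (fun v => esym (cf_mkqvf _ hk)) _.
  by do 12?[case: k hk => [|k] hk] => //=; solve_polyfun; apply: pK.
rewrite /generic_poly; apply: polyfunM; [apply: polyfunM => //|].
  by rewrite /res_inf /quad_res; solve_polyfun.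
apply: polyfunD; last apply: polyfunN; last apply: polyfunM; last 2 first.
- exact: polyfunX.
- by apply: polyfun_cubic_disc; solve_polyfun.
by apply: polyfun_cubic_disc; solve_polyfun; apply: pl.
Qed.

(** For [P = - x y], [Q = x^2 + y^2 - x] the resultant is 1, [divfree_mx] is [diag(2, 1)], and the
    two discriminants are -500 and -32, so the value is [1 * 2 * (-500 + 16 * 32) = 24]. *)
Lemma generic_poly_neq0 :
  generic_poly (mkqvf [:: 0; 0; 0; 0; - 1; 0; 0; - 1; 0; 1; 0; 1]) != 0.
Proof.
rewrite /generic_poly /res_inf /quad_res /disc_inf /cubic_disc det2E.
rewrite ![cf (lmulq _ _) _]cf_mkqvf //= !mulmx2E !mxE /= /det3 !cf_mkqvf //=.
set x := (X in X != 0); have -> : x = 24%:R by rewrite /x; ring.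
by rewrite pnatr_eq0.
Qed.

End QuadraticFields.

Theorem theorem1p4 (C : numClosedFieldType) :
  exists U : qvf C -> Prop,
    [/\ zariski_open U, (exists v, U v) &
        forall v, U v -> forall w : qvf C,
          four_nondeg_sing w -> same_spectra v w -> same_char_inf v w ->
          affine_equiv v w].
Proof.
have [p pE] := polyfun_generic C.
exists (fun v => generic_poly v != 0); split.
- by exists [:: p] => v; rewrite /= andbT pE; split=> [/negP|/negP].
- by exists (mkqvf [:: 0; 0; 0; 0; - 1; 0; 0; - 1; 0; 1; 0; 1]); apply: generic_poly_neq0.
- by move=> v gv w; apply: generic_affine_equiv.
Qed.
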